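(* Let $S=\{(d_0,q_0),\ldots,(d_M,q_M)\}$ be a regular alphabet--base system, with associated $\lambda,\Lambda$, maps $b,a,l,m$ and sequences $\alpha^j$ ($0\le j\le M-1$), $\gamma^j$ ($1\le j\le M$). (i) The greedy map $x\mapsto b(x)$ is an increasing bijection of $[\lambda,\Lambda]$ onto the set of all sequences $(j_i)$ satisfying: $(j_{n+i})\prec\alpha^{j_n}$ whenever $j_n<M$. (ii) The quasi-greedy map $x\mapsto a(x)$ is an increasing bijection of $[\lambda,\Lambda]$ onto the set of all infinite sequences $(j_i)$ satisfying: $(j_{n+i})\preceq\alpha^{j_n}$ whenever $j_n<M$. (iii) The lazy map $x\mapsto l(x)$ is an increasing bijection of $[\lambda,\Lambda]$ onto the set of all sequences $(j_i)$ satisfying: $(j_{n+i})\succ\gamma^{j_n}$ whenever $j_n>0$. (iv) The quasi-lazy map $x\mapsto m(x)$ is an increasing bijection of $[\lambda,\Lambda]$ onto the set of all co-infinite sequences $(j_i)$ satisfying: $(j_{n+i})\succeq\gamma^{j_n}$ whenever $j_n>0$. Here $(j_{n+i})$ denotes the shifted sequence $j_{n+1}j_{n+2}\cdots$, and $n$ ranges over all positive integers.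
   Context: Let $M\ge 1$ be an integer. An alphabet--base system is a finite indexed family $S=\{(d_0,q_0),\ldots,(d_M,q_M)\}$ of pairs of real numbers with $q_0,\ldots,q_M>1$. A sequence is an element $(j_i)=j_1j_2\cdots$ of $\{0,\ldots,M\}^{\mathbb N}$, $\mathbb N=\{1,2,\ldots\}$. For a sequence put $\pi((j_i))=\sum_{i=1}^{\infty}\frac{d_{j_i}}{q_{j_1}\cdots q_{j_i}}$ (this series always converges). A sequence $(j_i)$ is an expansion of $x\in\mathbb R$ if $\pi((j_i))=x$. Write $j^\infty$ for the constant sequence $jj\cdots$, so $\pi(j^\infty)=\frac{d_j}{q_j-1}$, and set $\lambda:=\min_j\pi(j^\infty)$, $\Lambda:=\max_j\pi(j^\infty)$. $S$ is regular if $\frac{d_0+\lambda}{q_0}<\frac{d_1+\lambda}{q_1}<\cdots<\frac{d_M+\lambda}{q_M}$, $\frac{d_0+\Lambda}{q_0}<\frac{d_1+\Lambda}{q_1}<\cdots<\frac{d_M+\Lambda}{q_M}$, and $\frac{d_j+\Lambda}{q_j}\ge\frac{d_{j+1}+\lambda}{q_{j+1}}$ for all $j<M$. Sequences are ordered lexicographically: $(j_i)\prec(k_i)$ if there is an index $n$ with $j_i=k_i$ for all $i<n$ and $j_n<k_n$; $\preceq$ means $\prec$ or $=$. ''Increasing'' refers to this order. A sequence is finite if it has a last nonzero element $j_n>0$, and infinite otherwise (so $0^\infty$ is infinite). A sequence is co-finite if it has a last element $j_n<M$, and co-infinite otherwise (so $M^\infty$ is co-infinite). For regular $S$ and $x\in[\lambda,\Lambda]$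 the following exist: the lexicographically largest expansion $b(x)$ of $x$ (greedy), the lexicographically largest infinite expansion $a(x)$ (quasi-greedy), the lexicographically smallest expansion $l(x)$ (lazy), and the lexicographically smallest co-infinite expansion $m(x)$ (quasi-lazy). Define $\alpha^j:=a\left(q_j\left(\frac{d_{j+1}+\lambda}{q_{j+1}}-\frac{d_j}{q_j}\right)\right)$ for $j=0,\ldots,M-1$, and $\gamma^j:=m\left(q_j\left(\frac{d_{j-1}+\Lambda}{q_{j-1}}-\frac{d_j}{q_j}\right)\right)$ for $j=1,\ldots,M$; the arguments lie in $[\lambda,\Lambda]$ when $S$ is regular. *)

(* Defs.v *)
From mathcomp Require Import all_boot all_order all_algebra.
From mathcomp Require Import all_classical all_reals all_analysis.
Set Implicit Arguments.
Unset Strict Implicit.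
Unset Printing Implicit Defensive.
Import Order.TTheory GRing.Theory Num.Theory.
Import numFieldNormedType.Exports.
Local Open Scope classical_set_scope.
Local Open Scope ring_scope.

Record alphabet_base_system (R : realType) (M : nat) := AlphabetBaseSystem {
  digit : 'I_M.+1 -> R ;
  base : 'I_M.+1 -> R ;
  base_gt1 : forall j, 1 < base j }.

(* Sequences are indexed from 0: [s i] is the element $j_{i+1}$ of
   $j_1 j_2 \cdots$.  [big_lexi_order] carries the lexicographic order. *)
Definition dseq (M : nat) : Type := big_lexi_order (fun _ : nat => 'I_M.+1).

Lemma lt_dseqP (M : nat) (s t : dseq M) :
  (s < t)%O <->
  exists n, (forall i, (i < n)%N -> s i = t i) /\ (s n < t n)%N.
Proof.
rewrite lt_neqAle leEbig_lexi_order; split=> [/andP[]|[n [st stn]]].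
  case E : (first_diff s t) => [n|]; last first.
    by move/first_diff_NoneP : E => ->; rewrite eqxx.
  move=> _ stn; move/first_diff_SomeP : E => [st neq]; exists n; split.
    by move=> i /st.
  by rewrite ltn_neqAle; apply/andP; split; [exact: neq | exact: stn].
have neq : s n != t n by apply: contraTN stn => /eqP ->; rewrite ltnn.
have -> : first_diff s t = Some n.
  by apply/first_diff_SomeP; split=> // i /st.
by apply/andP; split; [apply: contra neq => /eqP -> | exact: ltnW].
Qed.

Definition shift_seq (M n : nat) (s : dseq M) : dseq M :=
  fun i => s (n + i)%N.

Definition const_seq (M : nat) (j : 'I_M.+1) : dseq M := fun=> j.

Definition finite_seq (M : nat) (s : dseq M) : Prop :=
  exists n, (0 < s n)%N /\ forall i, (n < i)%N -> s i = ord0.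

Definition infinite_seq (M : nat) (s : dseq M) : Prop := ~ finite_seq s.

Definition cofinite_seq (M : nat) (s : dseq M) : Prop :=
  exists n, (s n < M)%N /\ forall i, (n < i)%N -> s i = ord_max.

Definition coinfinite_seq (M : nat) (s : dseq M) : Prop := ~ cofinite_seq s.

Section Expansions.
Variables (R : realType) (M : nat) (S : alphabet_base_system R M).
Local Notation d := (digit S).
Local Notation q := (base S).

Definition pi_seq (s : dseq M) : R :=
  limn (series (fun i => d (s i) / \prod_(k < i.+1) q (s k))).

Definition lambda_min : R :=
  \big[Num.min/pi_seq (const_seq ord0)]_(j < M.+1) pi_seq (const_seq j).

Definition Lambda_max : R :=
  \big[Num.max/pi_seq (const_seq ord0)]_(j < M.+1) pi_seq (const_seq j).

(* For [j < M], [inord j.+1] is the letter $j+1$. *)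
Definition regular_system : Prop :=
  [/\ forall j : 'I_M.+1, (j < M)%N ->
        (d j + lambda_min) / q j
          < (d (inord j.+1) + lambda_min) / q (inord j.+1),
      forall j : 'I_M.+1, (j < M)%N ->
        (d j + Lambda_max) / q j
          < (d (inord j.+1) + Lambda_max) / q (inord j.+1)
    & forall j : 'I_M.+1, (j < M)%N ->
        (d j + Lambda_max) / q j
          >= (d (inord j.+1) + lambda_min) / q (inord j.+1)].

Definition expansions (x : R) : set (dseq M) := [set s | pi_seq s = x].

(* The default value of [xget] is irrelevant where the extremum exists. *)
Definition lex_largest (E : set (dseq M)) : dseq M :=
  xget (const_seq ord0) (E `&` ubound E).

Definition lex_smallest (E : set (dseq M)) : dseq M :=
  xget (const_seq ord0) (E `&` lbound E).

Definition greedy_exp (x : R) : dseq M := lex_largest (expansions x).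

Definition quasi_greedy_exp (x : R) : dseq M :=
  lex_largest (expansions x `&` [set s | infinite_seq s]).

Definition lazy_exp (x : R) : dseq M := lex_smallest (expansions x).

Definition quasi_lazy_exp (x : R) : dseq M :=
  lex_smallest (expansions x `&` [set s | coinfinite_seq s]).

(* Only meaningful for [j < M]. *)
Definition alpha_seq (j : 'I_M.+1) : dseq M :=
  quasi_greedy_exp
    (q j * ((d (inord j.+1) + lambda_min) / q (inord j.+1) - d j / q j)).

(* Only meaningful for [0 < j]. *)
Definition gamma_seq (j : 'I_M.+1) : dseq M :=
  quasi_lazy_exp
    (q j * ((d (inord j.-1) + Lambda_max) / q (inord j.-1) - d j / q j)).

Definition increasing_bijection (f : R -> dseq M) (B : set (dseq M)) : Prop :=
  {in `[lambda_min, Lambda_max] &, {homo f : x y / x < y >-> (x < y)%O}} /\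
  set_bij `[lambda_min, Lambda_max] B f.

End Expansions.

(* Main.v *)
(** Reading a digit [j] applies the contraction [x |-> (d_j + x) / q_j], so the
    remainders [t_n = pi (shift_seq n s)] of any sequence satisfy
    [t_n = (d_j + t_(n+1)) / q_j] with [j = s n], and all lie in
    [[lambda, Lambda]]. A digit [j < M] is the greedy choice at [n] exactly when
    [t_(n+1)] is below the threshold whose quasi-greedy expansion is [alpha^j]
    (strictly below for greedy, weakly for quasi-greedy expansions), and two such
    sequences compare lexicographically as their values do.

    Conversely, if every shift is lexicographically dominated by the relevant
    [alpha^j], then at the first disagreement the excess of [t_(n+1)] over its
    threshold is at most the excess at a later index divided by a base; as
    excesses are bounded and the bases are uniformly greater than [1], there is
    no excess at all.

    The lazy statements are the greedy ones for the reflected system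
    [(- d_(M - j), q_(M - j))], under [x |-> - x] and [j |-> M - j]. *)
Require Import Defs.
From mathcomp Require Import all_boot all_order all_algebra.
From mathcomp Require Import all_classical all_reals all_analysis.
From mathcomp Require Import zify ring lra.
Set Implicit Arguments.
Unset Strict Implicit.
Unset Printing Implicit Defensive.
Import Order.TTheory GRing.Theory Num.Theory.
Import numFieldNormedType.Exports.
Local Open Scope classical_set_scope.
Local Open Scope ring_scope.

(** * Branch maps and truncated expansions *)

Definition branch (R : realType) (M : nat) (S : alphabet_base_system R M)
  (j : 'I_M.+1) (x : R) : R := (digit S j + x) / base S j.

Definition unbranch (R : realType) (M : nat) (S : alphabet_base_system R M)
  (j : 'I_M.+1) (x : R) : R := base S j * x - digit S j.

Definition pi_partial (R : realType) (M : nat) (S : alphabet_base_system R M)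
  (s : dseq M) : R^nat :=
  series (fun i => digit S (s i) / \prod_(k < i.+1) base S (s k)).

Section Expansions.
Variables (R : realType) (M : nat) (S : alphabet_base_system R M).
Local Notation d := (digit S).
Local Notation q := (base S).
Local Notation f := (branch S).
Local Notation pi := (pi_seq S).
Implicit Types (s t u : dseq M) (j : 'I_M.+1) (x y : R).

Lemma base_gt0 j : 0 < q j.
Proof. exact: lt_trans ltr01 (base_gt1 S j). Qed.

Lemma base_neq0 j : q j != 0.
Proof. exact: lt0r_neq0 (base_gt0 j). Qed.

Lemma branchK j : cancel (f j) (unbranch S j).
Proof. by move=> x; rewrite /unbranch /branch; field; exact: base_neq0. Qed.

Lemma unbranchK j : cancel (unbranch S j) (f j).
Proof. by move=> x; rewrite /unbranch /branch; field; exact: base_neq0. Qed.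

Lemma ler_branch j : {mono f j : x y / x <= y}.
Proof. by move=> x y; rewrite /branch ler_pM2r ?invr_gt0 ?base_gt0// lerD2l. Qed.

Lemma ltr_branch j : {mono f j : x y / x < y}.
Proof. exact: leW_mono (ler_branch j). Qed.

Lemma uniform_base_gt1 : exists2 c : R, 1 < c & forall j, c <= q j.
Proof.
pose i := [arg min_(i < ord0 : 'I_M.+1) q i]%O.
exists (q i) => [|j]; first exact: base_gt1.
by rewrite /i; case: arg_minP => // k _; apply.
Qed.

Lemma pi_partialSl s n :
  pi_partial S s n.+1 = f (s 0) (pi_partial S (shift_seq 1 s) n).
Proof.
rewrite /pi_partial /series /= big_nat_recl// big_ord1 /branch mulrDl.
congr (_ + _); rewrite mulr_suml; apply: eq_bigr => i _.
by rewrite big_ord_recl /shift_seq /= invfM mulrA mulrAC.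
Qed.

(** This is the composition of the branches of the first [n] digits of [s], applied to [x], in
    closed form. *)
Definition pi_prefix s n x := pi_partial S s n + x / \prod_(k < n) q (s k).

Lemma pi_prefix0 s x : pi_prefix s 0 x = x.
Proof.
by rewrite /pi_prefix /pi_partial /series /= big_geq// big_ord0 add0r divr1.
Qed.

Lemma pi_prefixS s n x : pi_prefix s n.+1 x = pi_prefix s n (f (s n) x).
Proof.
rewrite /pi_prefix /pi_partial seriesSr -addrA; congr (_ + _).
rewrite /branch big_ord_recr /= invfM.
by rewrite (mulrC (\prod_(_ < _) _)^-1) !mulrA -mulrDl; congr (_ * _); ring.
Qed.

Lemma pi_prefix_orbit s (r : R^nat) n :
  (forall n, r n = f (s n) (r n.+1)) -> pi_prefix s n (r n) = r 0%N.
Proof.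
by move=> rE; elim: n => [|n IH]; rewrite ?pi_prefix0// pi_prefixS -rE.
Qed.

(** Finitely many bases have a common lower bound [c > 1], so the quotient is dominated by
    [K / c ^ n]. *)
Lemma cvg_bounded_div_prod s (r : R^nat) (K : R) :
  (forall n, `|r n| <= K) ->
  (fun n => r n / \prod_(k < n) q (s k)) @ \oo --> (0 : R).
Proof.
move=> rK; have [c c1 cq] := uniform_base_gt1.
have c0 : 0 < c by exact: lt_trans ltr01 c1.
apply: norm_cvg0; apply: (@squeeze_cvgr _ _ _ _ (fun=> 0) (geometric K c^-1)).
- apply: nearW => n; rewrite normr_ge0 normrM /= ler_pM//.
  rewrite normfV ger0_norm; last first.
    by apply: prodr_ge0 => k _; exact/ltW/base_gt0.
  rewrite exprVn lef_pV2 ?posrE ?exprn_gt0//; last first.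
    by apply: prodr_gt0 => k _; exact: base_gt0.
  rewrite -[n in c ^+ n]card_ord -prodr_const; apply: ler_prod => k _.
  by rewrite (ltW c0) cq.
- exact: cvg_cst.
- by apply: cvg_geometric; rewrite ger0_norm ?invr_ge0 ?(ltW c0)// invf_lt1.
Qed.

(** The partial sums equal [r 0] up to the vanishing term [r n / prod]. This evaluates [pi] on
    constant sequences and on the output of a digit algorithm, with no prior convergence result. *)
Lemma pi_seq_orbit s (r : R^nat) (K : R) :
  (forall n, r n = f (s n) (r n.+1)) -> (forall n, `|r n| <= K) ->
  pi s = r 0%N.
Proof.
move=> rE rK; apply: cvg_lim => //.
have -> : series (fun i => d (s i) / \prod_(k < i.+1) q (s k)) =
    fun n => r 0%N - r n / \prod_(k < n) q (s k).
  by apply/funext => n; rewrite -(pi_prefix_orbit n rE) addrK.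
rewrite -[X in _ --> X]subr0.
by apply: cvgB; [exact: cvg_cst|exact: cvg_bounded_div_prod rK].
Qed.

Lemma pi_const j : pi (const_seq j) = d j / (q j - 1).
Proof.
have q1 : q j - 1 != 0 by rewrite subr_eq0 gt_eqF// base_gt1.
apply: (@pi_seq_orbit _ (fun=> d j / (q j - 1)) `|d j / (q j - 1)|) => // n.
by rewrite /branch /const_seq /=; field; rewrite q1 base_neq0.
Qed.

Lemma branch_pi_const j : f j (pi (const_seq j)) = pi (const_seq j).
Proof.
have q1 : q j - 1 != 0 by rewrite subr_eq0 gt_eqF// base_gt1.
by rewrite pi_const /branch; field; rewrite q1 base_neq0.
Qed.

(** * Convergence and the range of values *)

Local Notation lambda := (lambda_min S).
Local Notation Lambda := (Lambda_max S).

Lemma lambda_min_le j : lambda <= pi (const_seq j).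
Proof. exact: bigmin_le. Qed.

Lemma le_Lambda_max j : pi (const_seq j) <= Lambda.
Proof. exact: le_bigmax. Qed.

Lemma lambda_min_attained : exists j, lambda = pi (const_seq j).
Proof.
rewrite /lambda_min; elim/big_ind: _ => [|x y [i ->] [j ->]|i _].
- by exists ord0.
- by rewrite /Order.min; case: ifP => _; [exists i|exists j].
- by exists i.
Qed.

Lemma Lambda_max_attained : exists j, Lambda = pi (const_seq j).
Proof.
rewrite /Lambda_max; elim/big_ind: _ => [|x y [i ->] [j ->]|i _].
- by exists ord0.
- by rewrite /Order.max; case: ifP => _; [exists j|exists i].
- by exists i.
Qed.

Lemma branch_contract j x y : x <= y -> f j y - f j x <= y - x.
Proof.
move=> xy; rewrite /branch -mulrBl opprD addrACA subrr add0r.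
by rewrite ler_piMr ?subr_ge0// invf_le1 ?base_gt0// ltW ?base_gt1.
Qed.

(** The branch contracts towards its fixed point [pi (const_seq j)], which lies at or above
    [lambda], so it cannot move [lambda] down. *)
Lemma le_branch_lambda j : lambda <= f j lambda.
Proof.
have := branch_contract j (lambda_min_le j).
by rewrite branch_pi_const lerD2l lerN2.
Qed.

Lemma branch_Lambda_le j : f j Lambda <= Lambda.
Proof.
have := branch_contract j (le_Lambda_max j).
by rewrite branch_pi_const lerD2r.
Qed.

Lemma ler_pi_prefix s n : {homo pi_prefix s n : x y / x <= y}.
Proof.
move=> x y xy; rewrite /pi_prefix lerD2l ler_wpM2r// invr_ge0.
by apply: prodr_ge0 => k _; exact/ltW/base_gt0.
Qed.

Lemma pi_prefix_itv s n x :
  lambda <= x <= Lambda -> lambda <= pi_prefix s n x <= Lambda.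
Proof.
elim: n x => [|n IH] x /andP[lx xL].
  by rewrite pi_prefix0 lx.
rewrite pi_prefixS; apply: IH.
rewrite (le_trans (le_branch_lambda (s n))) ?ler_branch//=.
by rewrite (le_trans _ (branch_Lambda_le (s n))) ?ler_branch.
Qed.

Lemma lambda_le_Lambda : lambda <= Lambda.
Proof. exact: le_trans (lambda_min_le ord0) (le_Lambda_max ord0). Qed.

(* Since every branch moves [lambda] up, inserting [lambda] as remainder after
   [n] digits gives a nondecreasing bounded sequence. *)
Lemma cvg_pi_prefix_lambda s : cvgn (fun n => pi_prefix s n lambda).
Proof.
apply: nondecreasing_is_cvgn.
  apply/nondecreasing_seqP => n; rewrite pi_prefixS.
  exact: ler_pi_prefix (le_branch_lambda _).
exists Lambda => _ [n _ <-].
have /(pi_prefix_itv s n)/andP[] // : lambda <= lambda <= Lambda.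
by rewrite lexx lambda_le_Lambda.
Qed.

Lemma cvg_pi_partial s : pi_partial S s @ \oo --> pi s.
Proof.
suff : cvgn (pi_partial S s) by [].
have -> : pi_partial S s = fun n =>
    pi_prefix s n lambda - lambda / \prod_(k < n) q (s k).
  by apply/funext => n; rewrite /pi_prefix addrK.
apply: is_cvgB; first exact: cvg_pi_prefix_lambda.
apply/cvg_ex; exists 0.
exact: (@cvg_bounded_div_prod s (fun=> lambda) `|lambda|).
Qed.

Lemma pi_seq_itv s : lambda <= pi s <= Lambda.
Proof.
have cv : (fun n => pi_prefix s n lambda) @ \oo --> pi s.
  rewrite -[X in _ --> X]addr0; apply: cvgD; first exact: cvg_pi_partial.
  exact: (@cvg_bounded_div_prod s (fun=> lambda) `|lambda|).
have itv n : lambda <= pi_prefix s n lambda <= Lambda.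
  by apply: pi_prefix_itv; rewrite lexx lambda_le_Lambda.
apply/andP; split.
  by apply: (cvgr_to_ge cv); apply: nearW => n; case/andP: (itv n).
by apply: (cvgr_to_le cv); apply: nearW => n; case/andP: (itv n).
Qed.

(** * Remainders of shifted sequences and their thresholds *)

Lemma pi_seq_unfold s : pi s = f (s 0%N) (pi (shift_seq 1 s)).
Proof.
apply: cvg_lim => //; rewrite -cvg_shiftS -/(pi_partial S s).
under eq_fun do rewrite pi_partialSl /branch.
apply: cvgMr_tmp; apply: cvgD; first exact: cvg_cst.
exact: cvg_pi_partial.
Qed.

Lemma shift_seqD m n s : shift_seq m (shift_seq n s) = shift_seq (n + m) s.
Proof. by apply/funext => i; rewrite /shift_seq addnA. Qed.

Lemma shift_seq0 s : shift_seq 0 s = s.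
Proof. by apply/funext. Qed.

Lemma pi_shift n s :
  pi (shift_seq n s) = f (s n) (pi (shift_seq n.+1 s)).
Proof.
by rewrite pi_seq_unfold shift_seqD addn1 {1}/shift_seq addn0.
Qed.

Lemma pi_shift_agree s u k : (forall i, (i < k)%N -> s i = u i) ->
  (pi s < pi u) = (pi (shift_seq k s) < pi (shift_seq k u)).
Proof.
elim: k => [|k IH] su; first by rewrite !shift_seq0.
rewrite IH => [|i ik]; last by rewrite su// ltnW.
by rewrite !(pi_shift k) su// ltr_branch.
Qed.

Lemma ltr_letters (g : 'I_M.+1 -> R) :
  (forall j, (j < M)%N -> g j < g (inord j.+1)) ->
  forall i j : 'I_M.+1, (i < j)%N -> g i < g j.
Proof.
move=> gS i j; rewrite -(inord_val j); move: (leq_ord j).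
move: (nat_of_ord j) => n; elim: n => [|n IH] nM; first by rewrite inordK.
have gn : g (inord n) < g (inord n.+1).
  by have := gS (inord n); rewrite inordK ?ltnS ?(ltnW nM)//; exact.
rewrite inordK// ltnS leq_eqVlt => /predU1P[i_n|lt_in].
  by rewrite -(inord_val i) i_n.
by apply: lt_trans gn; apply: IH; rewrite ?inordK ?ltnS ?(ltnW nM)// ltnW.
Qed.

(** For [j < M], this is the remainder after digit [j] at which the value reaches the image of
    [lambda] under branch [j + 1], that is, where digit [j + 1] becomes available. *)
Definition threshold j : R := unbranch S j (f (inord j.+1) lambda).

(* [weak = false] describes greedy expansions, [weak = true] quasi-greedy
   ones: only the latter are restricted to infinite sequences, and only for
   them may a remainder reach the value at which the next digit becomes
   available. *)
Definition admissible (weak : bool) s : Prop := weak -> infinite_seq s.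

Definition greedy_like (weak : bool) s : Prop := admissible weak s /\
  forall n, (s n < M)%N -> pi (shift_seq n.+1 s) < threshold (s n) ?<= if weak.

Lemma infinite_shift n s : infinite_seq s -> infinite_seq (shift_seq n s).
Proof.
move=> sinf [k [sk s0]]; apply: sinf; exists (n + k)%N; split=> // i nki.
have ni : (n <= i)%N by exact: leq_trans (leq_addr k n) (ltnW nki).
by rewrite -(subnKC ni); apply: s0; rewrite ltn_subRL.
Qed.

(** * Consequences of regularity *)

Section Regular.
Hypothesis regS : regular_system S.

Lemma ltr_branch_lambda (i j : 'I_M.+1) : (i < j)%N -> f i lambda < f j lambda.
Proof. by have [reg _ _] := regS; exact: (ltr_letters reg). Qed.

(** Some branch fixes [lambda]. If its letter were nonzero, branch 0 would send [lambda] strictly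
    lower, which no branch does. *)
Lemma branch0_lambda : f ord0 lambda = lambda.
Proof.
have [j lE] := lambda_min_attained.
have fj : f j lambda = lambda by rewrite lE branch_pi_const.
have [->//|j0] := eqVneq ord0 j.
have : f ord0 lambda < f j lambda by apply: ltr_branch_lambda; rewrite lt0n eq_sym.
by rewrite fj ltNge le_branch_lambda.
Qed.

Lemma branch_max_Lambda : f ord_max Lambda = Lambda.
Proof.
have [j LE] := Lambda_max_attained.
have fj : f j Lambda = Lambda by rewrite LE branch_pi_const.
have [->//|jM] := eqVneq ord_max j.
have : f j Lambda < f ord_max Lambda.
  have [_ reg _] := regS; apply: (ltr_letters reg).
  by rewrite ltn_neqAle eq_sym -ltnS ltn_ord andbT.
by rewrite fj ltNge branch_Lambda_le.
Qed.

Lemma ltr_lambda_branch j : (0 < j)%N -> lambda < f j lambda.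
Proof. by move=> j0; rewrite -{1}branch0_lambda ltr_branch_lambda. Qed.

(** A nonzero digit puts the value strictly above [lambda], so the digit is 0; injectivity of branch
    0 then passes the value [lambda] on to the next remainder. *)
Lemma pi_shift_lambda s n :
  pi (shift_seq n s) = lambda -> forall i, (n <= i)%N -> s i = ord0.
Proof.
have step k : pi (shift_seq k s) = lambda ->
    s k = ord0 /\ pi (shift_seq k.+1 s) = lambda.
  rewrite pi_shift => fl; have [lpi _] := andP (pi_seq_itv (shift_seq k.+1 s)).
  have sk : s k = ord0.
    apply/eqP; rewrite -val_eqE -[_ == _]negbK -lt0n; apply/negP => /ltr_lambda_branch.
    by rewrite -[ltLHS]fl ltr_branch ltNge lpi.
  split=> //; apply: (can_inj (branchK ord0)).
  by rewrite branch0_lambda -sk.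
move=> sn i ni; apply: (proj1 (step i _)).
elim: i ni => [|i IH]; first by rewrite leqn0 => /eqP <-.
rewrite leq_eqVlt => /predU1P[<-//|/IH] /step[]//.
Qed.

Lemma infinite_pi_gt s n :
  infinite_seq s -> (0 < s n)%N -> lambda < pi (shift_seq n.+1 s).
Proof.
move=> sinf sn; have [lpi _] := andP (pi_seq_itv (shift_seq n.+1 s)).
rewrite lt_neqAle lpi andbT; apply/eqP => /esym/pi_shift_lambda s0.
by apply: sinf; exists n.
Qed.

Lemma threshold_itv j : (j < M)%N -> lambda <= threshold j <= Lambda.
Proof.
move=> jM; have [_ _ reg] := regS.
apply/andP; split; rewrite -(ler_branch j) unbranchK; last exact: reg.
by apply/ltW/ltr_branch_lambda; rewrite inordK.
Qed.

Lemma branch_threshold (i j : 'I_M.+1) : (i < j)%N -> f i (threshold i) <= f j lambda.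
Proof.
move=> ij; rewrite unbranchK.
have iM : (i < M)%N by apply: (leq_trans ij); rewrite -ltnS.
move: ij; rewrite leq_eqVlt => /predU1P[ij|ij].
  by rewrite [inord _](_ : _ = j)//; apply: val_inj; rewrite /= inordK.
by apply/ltW/ltr_branch_lambda; rewrite inordK.
Qed.

(** * Existence of greedy and quasi-greedy expansions *)

Lemma expansion_step (weak : bool) x : lambda <= x <= Lambda ->
  exists jy : 'I_M.+1 * R,
    [/\ lambda <= jy.2 <= Lambda, f jy.1 jy.2 = x,
        (jy.1 < M)%N -> jy.2 < threshold jy.1 ?<= if weak
      & weak -> jy.2 = lambda -> jy.1 = ord0].
Proof.
move=> /andP[lx xL].
(* The digit is the largest available one. Availability means [f j lambda <= x] in the greedy case
   and [f j lambda < x] in the quasi-greedy case; the strict form keeps the remainder after a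
   nonzero digit off [lambda]. Digit 0 is always allowed. *)
pose avail j := (j == ord0) || (f j lambda < x ?<= if ~~ weak).
have avail0 : avail ord0 by rewrite /avail eqxx.
pose j := [arg max_(j > ord0 | avail j) nat_of_ord j]%N.
have [availj maxj] : avail j /\ forall k, avail k -> (k <= j)%N.
  by rewrite /j; case: arg_maxnP.
have next : (j < M)%N -> x < f (inord j.+1) lambda ?<= if weak.
  move=> jM; have : ~~ avail (inord j.+1).
    by apply/negP => /maxj; rewrite inordK ?ltnn.
  rewrite negb_or => /andP[_]; move: {+}weak => [] /=; first by rewrite -leNgt.
  by rewrite -ltNge.
exists (j, unbranch S j x); split=> /=.
- apply/andP; split; rewrite -(ler_branch j) unbranchK.
    by case/predU1P: availj => [->|/lteifW//]; rewrite branch0_lambda.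
  (* Below [M], maximality bounds [x] by the next branch at [lambda], and the third regularity
     condition leaves no gap between neighbouring branches. *)
  have [jM|] := ltnP j M.
    by have [_ _ reg] := regS; exact: le_trans (lteifW (next jM)) (reg _ jM).
  move=> Mj; suff -> : j = ord_max by rewrite branch_max_Lambda.
  by apply/val_inj/eqP; rewrite eqn_leq Mj -ltnS ltn_ord.
- exact: unbranchK.
- move/next; rewrite /threshold; move: {+}weak => [] /=.
    by move=> ?; rewrite -(ler_branch j) !unbranchK.
  by move=> ?; rewrite -(ltr_branch j) !unbranchK.
- move=> wk yl; case/predU1P: availj => // ; rewrite wk /= -yl unbranchK.
  by rewrite ltxx.
Qed.

Lemma greedy_like_exists (weak : bool) x : lambda <= x <= Lambda ->
  exists2 s, pi s = x & greedy_like weak s.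
Proof.
move=> xI.
have /choice[g gP] : forall y, exists jy : 'I_M.+1 * R, lambda <= y <= Lambda ->
    [/\ lambda <= jy.2 <= Lambda, f jy.1 jy.2 = y,
        (jy.1 < M)%N -> jy.2 < threshold jy.1 ?<= if weak
      & weak -> jy.2 = lambda -> jy.1 = ord0].
  move=> y; have [yI|_] := boolP (lambda <= y <= Lambda).
    by have [jy jyP] := expansion_step weak yI; exists jy.
  (* This default is never reached: the remainders [r n] stay in the interval. *)
  by exists (ord0, 0).
pose r n := iter n (fun y => (g y).2) x.
pose s : dseq M := fun n => (g (r n)).1.
have rI n : lambda <= r n <= Lambda.
  by elim: n => [//|n IH] /=; have [] := gP _ IH.
have rK n : `|r n| <= `|lambda| + `|Lambda|.
  have := rI n; have := ler_norm Lambda; have := ler_norm (- lambda).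
  have := normr_ge0 lambda; have := normr_ge0 Lambda.
  by rewrite normrN ler_norml => ? ? ? ? /andP[? ?]; apply/andP; split; lra.
have piE n : pi (shift_seq n s) = r n.
  have rE m : r (n + m)%N = f (shift_seq n s m) (r (n + m.+1)%N).
    by rewrite addnS; have [_ ->] := gP _ (rI (n + m)%N).
  by rewrite (pi_seq_orbit rE (fun m => rK _)) addn0.
exists s; first by rewrite -(shift_seq0 s) piE.
split=> [wk [n [sn s0]]|n sn].
  (* After a last nonzero digit the remainder would be the value [lambda] of the zero sequence, and
     the step then forces that digit to be 0. *)
  suff sn0 : s n = ord0 by rewrite sn0 in sn.
  have [_ _ _] := gP _ (rI n); apply=> //; rewrite -[LHS]/(r n.+1) -piE.
  have -> : shift_seq n.+1 s = const_seq ord0.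
    by apply/funext => i; apply: s0; rewrite ltnS leq_addr.
  have [j lE] := lambda_min_attained.
  apply: (@pi_seq_orbit _ (fun=> lambda) `|lambda|) => // m.
  by rewrite branch0_lambda.
by rewrite piE; have [_ _ + _] := gP _ (rI n); exact.
Qed.

(** * Values against the lexicographic order *)

Lemma greedy_like_crossing (weak : bool) s u :
  greedy_like weak s -> (s < u)%O ->
  pi s <= pi u /\ (admissible weak u -> pi s < pi u).
Proof.
move=> [_ sP] /lt_dseqP[n [su sun]].
have sM : (s n < M)%N by apply: (leq_trans sun); rewrite -ltnS.
have [lu _] := andP (pi_seq_itv (shift_seq n.+1 u)).
(* At the first disagreement, the tail of [s] is at most [f (s n) (threshold (s n))], hence at most
   [f (u n) lambda], hence at most the tail of [u]. *)
have fsu := branch_threshold sun.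
split.
  rewrite leNgt (@pi_shift_agree _ _ n) => [|i /su//].
  rewrite -leNgt !(pi_shift n); apply: (@le_trans _ _ (f (u n) lambda)).
    by apply: le_trans fsu; rewrite ler_branch (lteifW (sP n sM)).
  by rewrite ler_branch.
move=> uadm; rewrite (pi_shift_agree su) !(pi_shift n).
(* Strictness comes from the last link when [weak] holds, since [u] is infinite and [u n] is
   nonzero, and from the first link otherwise. *)
move: uadm (sP n sM); case: weak {sP} => /= [/(_ isT) uinf|_] tle.
  apply: (@le_lt_trans _ _ (f (u n) lambda)).
    by apply: le_trans fsu; rewrite ler_branch.
  by rewrite ltr_branch infinite_pi_gt// (leq_trans _ sun).
apply: (@lt_le_trans _ _ (f (u n) lambda)); last by rewrite ler_branch.
by apply: lt_le_trans fsu; rewrite ltr_branch.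
Qed.

Lemma greedy_like_lt weak s u :
  greedy_like weak s -> pi u < pi s -> (u < s)%O.
Proof.
move=> sG pus; have [//|/(greedy_like_crossing sG)[psu _]|us] := ltgtP u s.
  by move: pus; rewrite ltNge psu.
by move: pus; rewrite us ltxx.
Qed.

Lemma greedy_like_le weak s u :
  greedy_like weak s -> admissible weak u -> pi u <= pi s -> (u <= s)%O.
Proof.
move=> sG uadm pus; rewrite leNgt; apply/negP.
by move=> /(greedy_like_crossing sG)[_ /(_ uadm)]; rewrite ltNge pus.
Qed.

(** Passing back through the common prefix applies the same contractions to both sides, so the slack
    [e] does not grow. *)
Lemma pi_shift_agree_add s u k e : (forall i, (i < k)%N -> s i = u i) ->
  0 <= e -> pi (shift_seq k s) < pi (shift_seq k u) + e -> pi s < pi u + e.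
Proof.
move=> + e0; elim: k => [|k IH] su; first by rewrite !shift_seq0.
move=> lt_k; apply: IH => [i ik|]; first by rewrite su// ltnW.
rewrite !(pi_shift k) su//.
move: lt_k; rewrite -(ltr_branch (u k)) => /lt_le_trans; apply.
have := @branch_contract (u k) (pi (shift_seq k.+1 u)) (pi (shift_seq k.+1 u) + e).
by rewrite lerDl => /(_ e0); lra.
Qed.

(* Lexicographic domination bounds a remainder by its threshold up to the
   error made at a later remainder, divided by at least one base. *)
Lemma lexi_lt_pi (c e : R) t u :
  0 < c -> (forall j, c <= q j) -> 0 <= e -> infinite_seq u ->
  (forall n, (t n < M)%N -> pi (shift_seq n.+1 t) <= threshold (t n) + e) ->
  (t < u)%O -> pi t < pi u + e / c.
Proof.
move=> c0 cq e0 uinf tP /lt_dseqP[n [tu tun]].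
have tM : (t n < M)%N by apply: (leq_trans tun); rewrite -ltnS.
apply: (pi_shift_agree_add tu); first by rewrite divr_ge0// ltW.
have fu : f (u n) lambda < pi (shift_seq n u).
  by rewrite pi_shift ltr_branch infinite_pi_gt// (leq_trans _ tun).
rewrite (pi_shift n t).
have := branch_threshold tun; have := tP n tM.
rewrite -(ler_branch (t n)) {2}/branch addrA mulrDl -/(f _ _) => le1 le2.
have : e / q (t n) <= e / c.
  by rewrite ler_wpM2l// lef_pV2 ?posrE ?base_gt0.
by lra.
Qed.

(** * Lexicographic characterization by threshold expansions *)

Section Thresholds.
Variable al : 'I_M.+1 -> dseq M.
Hypothesis pi_al : forall j, (j < M)%N -> pi (al j) = threshold j.
Hypothesis al_quasi : forall j, (j < M)%N -> greedy_like true (al j).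

Lemma lexi_le_pi s :
  (forall n, (s n < M)%N -> (shift_seq n.+1 s <= al (s n))%O) ->
  forall n, (s n < M)%N -> pi (shift_seq n.+1 s) <= threshold (s n).
Proof.
move=> sal n sM; have [c c1 cq] := uniform_base_gt1.
have c0 : 0 < c by exact: lt_trans ltr01 c1.
pose K := Lambda - lambda.
have K0 : 0 <= K by rewrite subr_ge0 lambda_le_Lambda.
(* The length of the interval is a trivial bound on the excess, and each round gains a factor
   [c^-1]. The induction covers all positions [k] at once because improving the bound at one
   position uses the old bound at later ones. *)
have bound m k : (s k < M)%N ->
    pi (shift_seq k.+1 s) <= threshold (s k) + geometric K c^-1 m.
  elim: m k => [|m IH] k skM.
    rewrite /geometric /= expr0 mulr1 /K.
    have /andP[+ _] := threshold_itv skM.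
    have /andP[_ +] := pi_seq_itv (shift_seq k.+1 s).
    by lra.
  have e0 : 0 <= geometric K c^-1 m.
    by rewrite /geometric /= mulr_ge0// exprn_ge0// invr_ge0 ltW.
  have eS : geometric K c^-1 m.+1 = geometric K c^-1 m / c.
    by rewrite /geometric /= exprSr mulrA.
  have := sal k skM; rewrite le_eqVlt => /predU1P[->|lt_al].
    by rewrite pi_al// lerDl eS divr_ge0// ltW.
  rewrite eS -pi_al// ltW//; apply: lexi_lt_pi => //.
    exact: (al_quasi skM).1.
  by move=> i; rewrite shift_seqD addnS; exact: IH.
have cv : (fun m => threshold (s n) + geometric K c^-1 m) @ \oo
    --> threshold (s n).
  rewrite -[X in _ --> X]addr0; apply: cvgD; first exact: cvg_cst.
  by apply: cvg_geometric; rewrite ger0_norm ?invr_ge0 ?(ltW c0)// invf_lt1.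
by apply: (cvgr_to_ge cv); apply: nearW => m; exact: bound.
Qed.

Lemma greedy_likeP (weak : bool) s : greedy_like weak s <->
  admissible weak s /\
  forall n, (s n < M)%N -> (shift_seq n.+1 s < al (s n) ?<= if weak)%O.
Proof.
split=> [[sadm sP]|[sadm sal]]; split=> // n sM.
  have alG := al_quasi sM; have := sP n sM; rewrite -pi_al//.
  case: weak sadm {sP} => /= [sinf|_]; last exact: (greedy_like_lt alG).
  move=> le_sal; apply: (greedy_like_le alG) le_sal => _.
  exact: infinite_shift (sinf isT).
have le_s : forall n, (s n < M)%N -> pi (shift_seq n.+1 s) <= threshold (s n).
  by apply: lexi_le_pi => k kM; exact: lteifW (sal k kM).
case: weak {sadm} sal => /= sal; first exact: le_s.
(* With the weak bounds known at every position, the comparison applies with error 0 and gives the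
   strict inequality. *)
have := sal n sM => /(lexi_lt_pi ltr01 (fun j => ltW (base_gt1 S j)) (lexx 0)).
rewrite mul0r addr0 pi_al//; apply; first exact: (al_quasi sM).1.
by move=> k; rewrite addr0 shift_seqD addnS; exact: le_s.
Qed.
End Thresholds.

(** * The greedy and quasi-greedy maps *)

Lemma lex_largestP (E : set (dseq M)) s : E s -> ubound E s -> lex_largest E = s.
Proof.
move=> Es ubs; apply: xget_subset1 => // t u [Et ubt] [Eu ubu].
by apply/le_anti; rewrite ubu// ubt.
Qed.

Lemma greedy_expE s : greedy_like false s -> greedy_exp S (pi s) = s.
Proof.
move=> sG; apply: lex_largestP => // u /= pu.
by apply: (greedy_like_le sG) => //; rewrite pu.
Qed.

Lemma quasi_greedy_expE s : greedy_like true s -> quasi_greedy_exp S (pi s) = s.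
Proof.
move=> sG; apply: lex_largestP => [|u [/= pu uinf]].
  by split=> //; apply: sG.1.
by apply: (greedy_like_le sG) => //; rewrite pu.
Qed.

Lemma alpha_seqE j : alpha_seq S j = quasi_greedy_exp S (threshold j).
Proof.
congr quasi_greedy_exp; rewrite /threshold /unbranch /branch.
by field; rewrite !base_neq0.
Qed.

Lemma alpha_seq_spec j : (j < M)%N ->
  pi (alpha_seq S j) = threshold j /\ greedy_like true (alpha_seq S j).
Proof.
move=> jM; rewrite alpha_seqE.
have [s <- sG] := greedy_like_exists true (threshold_itv jM).
by rewrite quasi_greedy_expE.
Qed.

Lemma greedy_like_alphaP (weak : bool) s : greedy_like weak s <->
  admissible weak s /\
  forall n, (s n < M)%N -> (shift_seq n.+1 s < alpha_seq S (s n) ?<= if weak)%O.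
Proof. by apply: greedy_likeP => j /alpha_seq_spec[]. Qed.

(** Every point of the interval is the value of a greedy-like sequence, so [b] and [pi] are mutually
    inverse; monotonicity is the lexicographic comparison of such sequences. *)
Lemma greedy_like_increasing_bijection (weak : bool) (b : R -> dseq M) :
  (forall s, greedy_like weak s -> b (pi s) = s) ->
  increasing_bijection S b [set s | greedy_like weak s].
Proof.
move=> bpi.
have bP x : lambda <= x <= Lambda -> pi (b x) = x /\ greedy_like weak (b x).
  by move=> /(greedy_like_exists weak)[s <- sG]; rewrite bpi.
split=> [x y xI yI xy|].
  have [px _] := bP x xI; have [py yG] := bP y yI.
  by apply: (greedy_like_lt yG); rewrite px py.
split=> [x /bP[_]//|x y /set_mem/bP[px _] /set_mem/bP[py _] bxy|s sG].
  by rewrite -px bxy.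
by exists (pi s); [exact: pi_seq_itv|exact: bpi].
Qed.

Lemma greedy_exp_bijection : increasing_bijection S (greedy_exp S)
  [set s : dseq M | forall n, (s n < M)%N ->
     (shift_seq n.+1 s < alpha_seq S (s n))%O].
Proof.
rewrite [X in increasing_bijection _ _ X](_ : _ = [set s | greedy_like false s]).
  exact: greedy_like_increasing_bijection greedy_expE.
by apply/seteqP; split=> s /=; rewrite greedy_like_alphaP => // -[].
Qed.

Lemma quasi_greedy_exp_bijection : increasing_bijection S (quasi_greedy_exp S)
  [set s : dseq M | infinite_seq s /\
     forall n, (s n < M)%N -> (shift_seq n.+1 s <= alpha_seq S (s n))%O].
Proof.
rewrite [X in increasing_bijection _ _ X](_ : _ = [set s | greedy_like true s]).
  exact: greedy_like_increasing_bijection quasi_greedy_expE.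
apply/seteqP; split=> s /=; rewrite greedy_like_alphaP => -[sinf ?]; split=> //.
exact: sinf.
Qed.

Lemma greedy_exp_max x : lambda <= x <= Lambda ->
  pi (greedy_exp S x) = x /\ ubound (expansions S x) (greedy_exp S x).
Proof.
move=> /(greedy_like_exists false)[s <- sG]; rewrite greedy_expE//.
by split=> // u /= pu; apply: (greedy_like_le sG) => //; rewrite pu.
Qed.

Lemma quasi_greedy_exp_max x : lambda <= x <= Lambda ->
  [/\ pi (quasi_greedy_exp S x) = x, infinite_seq (quasi_greedy_exp S x)
    & ubound (expansions S x `&` [set s | infinite_seq s]) (quasi_greedy_exp S x)].
Proof.
move=> /(greedy_like_exists true)[s <- sG]; rewrite quasi_greedy_expE//.
split=> //; first exact: sG.1.
by move=> u [/= pu uinf]; apply: (greedy_like_le sG) => //; rewrite pu.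
Qed.
End Regular.
End Expansions.

(** * Reflection of systems and sequences *)

Definition flip_seq (M : nat) (s : dseq M) : dseq M := fun i => rev_ord (s i).

Definition reflect_system (R : realType) (M : nat)
    (S : alphabet_base_system R M) : alphabet_base_system R M :=
  {| digit := fun j => - digit S (rev_ord j);
     base := fun j => base S (rev_ord j);
     base_gt1 := fun j => base_gt1 S (rev_ord j) |}.

Section Reflection.
Variables (R : realType) (M : nat) (S : alphabet_base_system R M).
Local Notation pi := (pi_seq S).
Local Notation S' := (reflect_system S).
Implicit Types (s t : dseq M) (j : 'I_M.+1) (x : R).

Lemma flip_seqK : involutive (@flip_seq M).
Proof. by move=> s; apply/funext => i; exact: rev_ordK. Qed.

Lemma lt_flip_seq s t : (flip_seq s < flip_seq t)%O = (t < s)%O.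
Proof.
have impl u v : (u < v)%O -> (flip_seq v < flip_seq u)%O.
  move=> /lt_dseqP[n [uv lt_n]]; apply/lt_dseqP; exists n; split.
    by move=> i /uv; rewrite /flip_seq => ->.
  by rewrite /flip_seq /= ltn_sub2l// ltnS (leq_trans lt_n)// -ltnS.
by apply/idP/idP => /impl//; rewrite !flip_seqK.
Qed.

Lemma le_flip_seq s t : (flip_seq s <= flip_seq t)%O = (t <= s)%O.
Proof. by rewrite !leNgt lt_flip_seq. Qed.

Lemma rev_ord_lt_max j : (rev_ord j < M)%N = (0 < j)%N.
Proof. by have := ltn_ord j; rewrite /=; lia. Qed.

Lemma rev_ord_gt0 j : (0 < rev_ord j)%N = (j < M)%N.
Proof. by rewrite -rev_ord_lt_max rev_ordK. Qed.

Lemma rev_ord_max : rev_ord ord_max = ord0 :> 'I_M.+1.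
Proof. by apply: val_inj; rewrite /= subnn. Qed.

Lemma finite_flip_seq s : Defs.finite_seq (flip_seq s) <-> cofinite_seq s.
Proof.
split=> -[n [sn s0]]; exists n; split.
- by rewrite -rev_ord_gt0.
- by move=> i /s0 fs; apply: rev_ord_inj; rewrite rev_ord_max.
- by rewrite rev_ord_gt0.
- by move=> i /s0; rewrite /flip_seq => ->; exact: rev_ord_max.
Qed.

Lemma infinite_flip_seq s : infinite_seq (flip_seq s) <-> coinfinite_seq s.
Proof. exact: not_iff_compat (finite_flip_seq s). Qed.

Lemma shift_flip_seq n s : shift_seq n (flip_seq s) = flip_seq (shift_seq n s).
Proof. by []. Qed.

Lemma pi_reflect s : pi_seq S' s = - pi (flip_seq s).
Proof.
apply: cvg_lim => //.
rewrite (_ : series _ = fun n => - pi_partial S (flip_seq s) n).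
  by apply: cvgN; exact: cvg_pi_partial.
apply/funext => n; rewrite /pi_partial /series /= -sumrN.
by apply: eq_bigr => i _; rewrite mulNr.
Qed.

Lemma pi_reflect_const j :
  pi_seq S' (const_seq j) = - pi (const_seq (rev_ord j)).
Proof. exact: pi_reflect. Qed.

Lemma lambda_min_reflect : lambda_min S' = - Lambda_max S.
Proof.
apply/le_anti/andP; split.
  have [j ->] := Lambda_max_attained S.
  by rewrite -[j]rev_ordK -pi_reflect_const lambda_min_le.
have [j ->] := lambda_min_attained S'.
by rewrite pi_reflect_const lerN2 le_Lambda_max.
Qed.

Lemma Lambda_max_reflect : Lambda_max S' = - lambda_min S.
Proof.
apply/le_anti/andP; split.
  have [j ->] := Lambda_max_attained S'.
  by rewrite pi_reflect_const lerN2 lambda_min_le.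
have [j ->] := lambda_min_attained S.
by rewrite -[j]rev_ordK -pi_reflect_const le_Lambda_max.
Qed.

Lemma reflect_itv x : lambda_min S <= x <= Lambda_max S ->
  lambda_min S' <= - x <= Lambda_max S'.
Proof. by rewrite lambda_min_reflect Lambda_max_reflect !lerN2 andbC. Qed.

Lemma branch_reflect j x : branch S' j (- x) = - branch S (rev_ord j) x.
Proof. by rewrite /branch /= -opprD mulNr. Qed.

Lemma rev_inordS j : (j < M)%N -> rev_ord (inord j.+1) = inord (rev_ord j).-1 :> 'I_M.+1.
Proof.
by move=> jM; apply: val_inj; rewrite /= !inordK ?ltnS//=; lia.
Qed.

Lemma rev_inordK j : (j < M)%N -> inord (rev_ord (inord j.+1 : 'I_M.+1)).+1 = rev_ord j.
Proof.
by move=> jM; apply: val_inj; rewrite /= !inordK ?ltnS//=; lia.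
Qed.

(** Reflection exchanges the first two conditions and preserves the third. Each is used at the
    letter [rev_ord (j + 1)], whose successor is [rev_ord j]. *)
Lemma reflect_regular : regular_system S -> regular_system S'.
Proof.
move=> [reg1 reg2 reg3].
have rM j : (j < M)%N -> (rev_ord (inord j.+1 : 'I_M.+1) < M)%N.
  by move=> jM; rewrite rev_ord_lt_max inordK.
split=> j jM; rewrite -!/(branch S' _ _) ?lambda_min_reflect ?Lambda_max_reflect.
- by rewrite !branch_reflect ltrN2 -(rev_inordK jM); apply: reg2 (rM j jM).
- by rewrite !branch_reflect ltrN2 -(rev_inordK jM); apply: reg1 (rM j jM).
- by rewrite !branch_reflect lerN2 -(rev_inordK jM); apply: reg3 (rM j jM).
Qed.

Lemma lex_smallestP (E : set (dseq M)) s :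
  E s -> lbound E s -> lex_smallest E = s.
Proof.
move=> Es lbs; apply: xget_subset1 => // t u [Et lbt] [Eu lbu].
by apply/le_anti; rewrite lbt// lbu.
Qed.

Lemma reflect_bijection (b b' : R -> dseq M) (B : set (dseq M)) :
  (forall x, lambda_min S <= x <= Lambda_max S -> b x = flip_seq (b' (- x))) ->
  increasing_bijection S' b' B ->
  increasing_bijection S b [set s | B (flip_seq s)].
Proof.
move=> bE [b'_lt [b'_fun b'_inj b'_surj]]; split=> [x y xI yI xy|].
  rewrite !bE// lt_flip_seq; apply: b'_lt; last by rewrite ltrN2.
    exact: reflect_itv.
  exact: reflect_itv.
split=> [x xI|x y /set_mem xI /set_mem yI|s Bs].
- by rewrite /= bE// flip_seqK; apply: b'_fun; exact: reflect_itv.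
- rewrite !bE// => /(can_inj flip_seqK) bxy; apply: oppr_inj.
  by apply: b'_inj bxy; apply/mem_set; exact: reflect_itv.
- have [x xI bx] := b'_surj _ Bs.
  have xI' : lambda_min S <= - x <= Lambda_max S.
    move: xI; rewrite /= in_itv /= lambda_min_reflect Lambda_max_reflect.
    by rewrite lerNl lerNr andbC.
  by exists (- x) => //; rewrite bE// opprK bx flip_seqK.
Qed.

(** * The lazy and quasi-lazy maps *)

Hypothesis regS : regular_system S.

(** Flipping carries expansions of [- x] in the reflected system to expansions of [x] and reverses
    the order, so the largest becomes the smallest. *)
Lemma lazy_exp_reflect x : lambda_min S <= x <= Lambda_max S ->
  lazy_exp S x = flip_seq (greedy_exp S' (- x)).
Proof.
move=> /reflect_itv/(greedy_exp_max (reflect_regular regS))[px ubx].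
apply: lex_smallestP => [/=|s /= ps].
  by apply: oppr_inj; rewrite /= -pi_reflect.
rewrite -le_flip_seq flip_seqK; apply: ubx.
by rewrite /expansions /mkset pi_reflect flip_seqK ps.
Qed.

Lemma quasi_lazy_exp_reflect x : lambda_min S <= x <= Lambda_max S ->
  quasi_lazy_exp S x = flip_seq (quasi_greedy_exp S' (- x)).
Proof.
move=> /reflect_itv/(quasi_greedy_exp_max (reflect_regular regS))[px infx ubx].
apply: lex_smallestP => [/=|s [/= ps /infinite_flip_seq sinf]].
  split; first by apply: oppr_inj; rewrite /= -pi_reflect.
  by apply/infinite_flip_seq; rewrite flip_seqK.
rewrite -le_flip_seq flip_seqK; apply: ubx; split=> //.
by rewrite /expansions /mkset pi_reflect flip_seqK ps.
Qed.

(** The point whose quasi-lazy expansion defines [gamma_seq S j] is the negative of the reflected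
    threshold at [rev_ord j]. *)
Lemma gamma_seq_reflect j : (0 < j)%N ->
  gamma_seq S j = flip_seq (alpha_seq S' (rev_ord j)).
Proof.
move=> j0; have rM : (rev_ord j < M)%N by rewrite rev_ord_lt_max.
have := threshold_itv (reflect_regular regS) rM.
rewrite alpha_seqE lambda_min_reflect Lambda_max_reflect => thI.
rewrite -[threshold _ _]opprK -quasi_lazy_exp_reflect; last first.
  by rewrite lerNr lerNl andbC.
congr quasi_lazy_exp; rewrite /threshold lambda_min_reflect branch_reflect.
rewrite rev_inordS// rev_ordK /unbranch /branch /= rev_ordK.
by field; rewrite !base_neq0.
Qed.

Lemma lazy_exp_bijection : increasing_bijection S (lazy_exp S)
  [set s : dseq M | forall n, (0 < s n)%N ->
     (shift_seq n.+1 s > gamma_seq S (s n))%O].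
Proof.
rewrite [X in increasing_bijection _ _ X](_ : _ = [set s | [set u : dseq M |
    forall n, (u n < M)%N -> (shift_seq n.+1 u < alpha_seq S' (u n))%O]
    (flip_seq s)]).
  apply: reflect_bijection lazy_exp_reflect _.
  exact: greedy_exp_bijection (reflect_regular regS).
apply/seteqP; split=> s /= sP n sn.
  have {}sn : (0 < s n)%N by rewrite -rev_ord_lt_max.
  have := sP n sn; rewrite gamma_seq_reflect// -lt_flip_seq flip_seqK.
  by rewrite shift_flip_seq.
rewrite gamma_seq_reflect// -lt_flip_seq flip_seqK -shift_flip_seq.
by apply: sP; rewrite rev_ord_lt_max.
Qed.

Lemma quasi_lazy_exp_bijection : increasing_bijection S (quasi_lazy_exp S)
  [set s : dseq M | coinfinite_seq s /\
     forall n, (0 < s n)%N -> (shift_seq n.+1 s >= gamma_seq S (s n))%O].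
Proof.
rewrite [X in increasing_bijection _ _ X](_ : _ = [set s | [set u : dseq M |
    infinite_seq u /\
    forall n, (u n < M)%N -> (shift_seq n.+1 u <= alpha_seq S' (u n))%O]
    (flip_seq s)]).
  apply: reflect_bijection quasi_lazy_exp_reflect _.
  exact: quasi_greedy_exp_bijection (reflect_regular regS).
apply/seteqP; split=> s /= [/infinite_flip_seq sinf sP]; split=> // n sn.
  have {}sn : (0 < s n)%N by rewrite -rev_ord_lt_max.
  have := sP n sn; rewrite gamma_seq_reflect// -le_flip_seq flip_seqK.
  by rewrite shift_flip_seq.
rewrite gamma_seq_reflect// -le_flip_seq flip_seqK -shift_flip_seq.
by apply: sP; rewrite rev_ord_lt_max.
Qed.
End Reflection.

Theorem theorem1p2 (R : realType) (M : nat) (hM : (1 <= M)%N)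
    (S : alphabet_base_system R M) (hS : regular_system S) :
  [/\ increasing_bijection S (greedy_exp S)
        [set s : dseq M | forall n, (s n < M)%N ->
           (shift_seq n.+1 s < alpha_seq S (s n))%O],
      increasing_bijection S (quasi_greedy_exp S)
        [set s : dseq M | infinite_seq s /\
           forall n, (s n < M)%N -> (shift_seq n.+1 s <= alpha_seq S (s n))%O],
      increasing_bijection S (lazy_exp S)
        [set s : dseq M | forall n, (0 < s n)%N ->
           (shift_seq n.+1 s > gamma_seq S (s n))%O]
    & increasing_bijection S (quasi_lazy_exp S)
        [set s : dseq M | coinfinite_seq s /\
           forall n, (0 < s n)%N -> (shift_seq n.+1 s >= gamma_seq S (s n))%O]].
Proof.
split.
- exact: greedy_exp_bijection.
- exact: quasi_greedy_exp_bijection.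
- exact: lazy_exp_bijection.
- exact: quasi_lazy_exp_bijection.
Qed.
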